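(* Let $(\Xi,d_\Xi)$ be a complete metric space and $\{\theta_t:t\in\mathbb{R}\}$ a group of continuous operators on $\Xi$ such that $(t,\sigma)\mapsto\theta_t\sigma$ is continuous. Let $g\in\Xi$ and $\Sigma=\mathcal{H}_\Xi(g)$. Let $\{U_\sigma(t,s):t\ge s\}_{\sigma\in\Sigma}$ be a system of evolution processes in the Banach space $X$ with a closed, bounded, uniformly absorbing set $\mathcal{B}\subset X$. Suppose: (1) There is a Banach space $Y$ compactly embedded in $X$. (2) For every $t>0$ there is $\kappa(t)>0$ such that $\sup_{\sigma\in\Sigma}\|U_\sigma(t,0)x-U_\sigma(t,0)y\|_Y\le\kappa(t)\|x-y\|_X$ for all $x,y\in\mathcal{B}$. (3) There are exponents $\gamma,\theta>0$ and, for each $r>0$, a constant $C(r)$ such that for all $s\in\mathbb{R}$, $\sigma\in\Sigma$, $x,y\in\mathcal{B}$ and $t,\tilde t\in[0,r]$, $$\|U_\sigma(t+s,s)x-U_\sigma(\tilde t+s,s)y\|_X\le C(r)\left(\|x-y\|_X^\gamma+|t-\tilde t|^\theta\right).$$ (4) There exist constants $P\ge1$ and $\zeta>0$ such that for all $t\ge0$ and all $\xi_1,\xi_2\in\Xi$, $d_\Xi(\theta_t\xi_1,\theta_t\xi_2)\le Pe^{\zeta t}d_\Xi(\xi_1,\xi_2)$. (5) For all $t\ge1$, $\sigma_1,\sigma_2\in\Sigma$ and $x\in\mathcal{B}$, $$\|U_{\sigma_1}(t,0)x-U_{\sigma_2}(t,0)x\|_X\le L(t)\,d_\Xi(\sigma_1,\sigma_2),$$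 where $1\le L(t)\le c_1e^{\beta t}$ for all $t\ge1$, for some constants $c_1,\beta>0$. Suppose also that there exist a compact invariant set $\Sigma_-\subset\Xi$ of finite box-counting dimension such that $\alpha(g)\subset\Sigma_-$, and constants $\eta_1>0$, $C\ge1$ such that $$\mathrm{dist}(\theta_tg,\Sigma_-)\le Ce^{\eta_1t},\qquad t\in\mathbb{R}.$$ Let $\{A_g(t):t\in\mathbb{R}\}$ denote the pullback attractor of $\{U_g(t,s):t\ge s\}$. Then for any $T\in\mathbb{R}$, $$d_B\Big(\bigcup_{t\le T}A_g(t)\Big)<\infty.$$
   Context: $(X,\|\cdot\|_X)$ is a Banach space. An evolution process in $X$ is a family of continuous maps $U(t,s):X\to X$, $t\ge s$ real, with $U(s,s)=\mathrm{Id}_X$, $U(t,s)U(s,r)=U(t,r)$ for $t\ge s\ge r$, and such that for each $x\in X$ the map $(t,s)\mapsto U(t,s)x$ is continuous on $\{t\ge s\}$. A group of operators on $\Xi$ satisfies $\theta_0=\mathrm{Id}$, $\theta_t\theta_s=\theta_{t+s}$ for $t,s\in\mathbb{R}$. (The operators $\theta_t$ are unrelated to the Hölder exponent $\theta$.) A set $\Sigma'\subset\Xi$ is invariant if $\theta_t\Sigma'=\Sigma'$ for all $t\in\mathbb{R}$. The hull of $g$ is $\mathcal{H}_\Xi(g)=\overline{\{\theta_rg:r\in\mathbb{R}\}}$ (closure in $\Xi$); the symbol space $\Sigma$ is assumed compact. $\alpha(g)$ is the set of all limits $\lim_n\theta_{t_n}g$ that exist along sequences $t_n\to-\infty$. $\mathrm{dist}(\xi,S)=\inf_{\eta\in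 S}d_\Xi(\xi,\eta)$. A system of evolution processes $\{U_\sigma(t,s):t\ge s\}_{\sigma\in\Sigma}$, with $\Sigma\subset\Xi$ compact and invariant, is a family of evolution processes in $X$ such that $U_{\theta_h\sigma}(t,s)=U_\sigma(t+h,s+h)$ for all $\sigma\in\Sigma$, $t\ge s$, $h\in\mathbb{R}$. A set $\mathcal{B}\subset X$ is uniformly absorbing if for each bounded $B\subset X$ there is $t_B\ge0$ with $U_\sigma(t,0)B\subset\mathcal{B}$ for all $t\ge t_B$ and all $\sigma\in\Sigma$. $\mathrm{dist}_H(A,B)=\sup_{x\in A}\inf_{y\in B}\|x-y\|_X$. The pullback attractor of an evolution process $\{U(t,s)\}$ is a family $\{A(t):t\in\mathbb{R}\}$ of compact subsets of $X$ with $\bigcup_{t\in\mathbb{R}}A(t)$ bounded, $U(t,s)A(s)=A(t)$ for all $t\ge s$, and $\mathrm{dist}_H(U(t,s)B,A(t))\to0$ as $s\to-\infty$ for every $t\in\mathbb{R}$ and bounded $B\subset X$. For a subset $K$ of a metric space $Z$ and $r>0$, $N_Z(K,r)$ is the minimal number of open balls of $Z$ of radius $r$ needed to cover $K$, and $d_B(K)=\limsup_{r\to0}\frac{\log N_Z(K,r)}{-\log r}$ is the box-counting dimension. *)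

(* Defs.v *)
From HB Require Import structures.
From mathcomp Require Import all_boot all_order all_algebra.
From mathcomp Require Import all_classical all_reals all_analysis.

Set Implicit Arguments.
Unset Strict Implicit.
Unset Printing Implicit Defensive.

Import Order.TTheory GRing.Theory Num.Theory.
Import numFieldNormedType.Exports.

Local Open Scope classical_set_scope.
Local Open Scope ring_scope.

(* The library's completeType would impose a distinguished point. *)
Definition complete_space (R : realType) (Z : metricType R) : Prop :=
  forall F : set_system Z, ProperFilter F -> cauchy F -> exists z : Z, F --> z.

(* The value is +oo when K has no finite cover by r-balls. *)
Definition covering_number (R : realType) (Z : pseudoMetricType R)
    (K : set Z) (r : R) : \bar R :=
  ereal_inf [set n%:R%:E | n in
    [set n : nat | exists c : 'I_n -> Z, K `<=` \bigcup_i ball (c i) r]].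

Definition box_dim (R : realType) (Z : pseudoMetricType R) (K : set Z) : \bar R :=
  limf_esup (fun r : R => lne (covering_number K r) * ((- ln r)^-1)%:E)%E 0^'+.

Definition compact_embedding (R : realType) (Y X : normedModType R)
    (j : {linear Y -> X}) : Prop :=
  [/\ injective j, continuous j &
      forall B : set Y, bounded_set B -> compact (closure (j @` B))].

(* In the definitions below only the values U t s with s <= t matter. *)
Definition evolution_process (R : realType) (X : normedModType R)
    (U : R -> R -> X -> X) : Prop :=
  [/\ forall t s : R, s <= t -> continuous (U t s),
      forall s x, U s s x = x,
      forall (t s r : R) x, r <= s -> s <= t -> U t s (U s r x) = U t r x &
      forall x, {within [set p : R * R | p.2 <= p.1],
                  continuous (fun p : R * R => U p.1 p.2 x)}].

Definition operator_group (R : realType) (Xi : Type) (th : R -> Xi -> Xi) : Prop :=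
  (forall xi, th 0 xi = xi) /\
  (forall t s xi, th t (th s xi) = th (t + s) xi).

Definition invariant_set (R : realType) (Xi : Type) (th : R -> Xi -> Xi)
    (S : set Xi) : Prop :=
  forall t, th t @` S = S.

Definition hull (R : realType) (Xi : metricType R) (th : R -> Xi -> Xi)
    (g : Xi) : set Xi :=
  closure [set th r g | r in [set: R]].

Definition alpha_limit (R : realType) (Xi : metricType R) (th : R -> Xi -> Xi)
    (g : Xi) : set Xi :=
  [set xi | exists t_ : nat -> R,
     (t_ n @[n --> \oo] --> -oo) /\ (th (t_ n) g @[n --> \oo] --> xi)].

(* Equal to +oo when S is empty. *)
Definition dist_to_set (R : realType) (Xi : metricType R) (xi : Xi)
    (S : set Xi) : \bar R :=
  ereal_inf [set (mdist xi eta)%:E | eta in S].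

Definition evolution_system (R : realType) (Xi : metricType R)
    (X : normedModType R) (th : R -> Xi -> Xi) (Sigma : set Xi)
    (U : Xi -> R -> R -> X -> X) : Prop :=
  [/\ compact Sigma,
      invariant_set th Sigma,
      forall sigma, Sigma sigma -> evolution_process (U sigma) &
      forall sigma (t s h : R) x, Sigma sigma -> s <= t ->
        U (th h sigma) t s x = U sigma (t + h) (s + h) x].

Definition uniformly_absorbing (R : realType) (Xi : Type) (X : normedModType R)
    (Sigma : set Xi) (U : Xi -> R -> R -> X -> X) (BB : set X) : Prop :=
  forall B : set X, bounded_set B ->
    exists2 tB : R, 0 <= tB &
      forall (t : R) sigma, tB <= t -> Sigma sigma -> U sigma t 0 @` B `<=` BB.

Definition dist_H (R : realType) (X : normedModType R) (A B : set X) : \bar R :=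
  ereal_sup [set ereal_inf [set `|x - y|%:E | y in B] | x in A].

(* B is taken nonempty because the supremum over the empty set is -oo here. *)
Definition is_pullback_attractor (R : realType) (X : normedModType R)
    (U : R -> R -> X -> X) (A : R -> set X) : Prop :=
  [/\ forall t, compact (A t),
      bounded_set (\bigcup_t A t),
      forall t s : R, s <= t -> U t s @` A s = A t &
      forall t (B : set X), bounded_set B -> B !=set0 ->
        dist_H (U t s @` B) (A t) @[s --> -oo] --> 0%E].

(* Main.v *)
(* The smoothing estimate and the compactness of Y in X give N such that, for
   every symbol, the time-tau map sends a piece of BB of diameter rho into N
   pieces of diameter rho / e; hence U_sigma(k tau, 0) BB is covered by N^k
   pieces of diameter e^(b - k), uniformly in sigma. At scale e^(-x) take
   k ~ x. The sections A_g(t) lie in such sets and so have polynomial covering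
   numbers, uniformly in t. For t <= - M x the symbols driving A_g(t) are
   exponentially close to Sigma_-, so polynomially many of them form an
   e^(- Z x)-net, and the Lipschitz dependence on the symbol, of constant
   L(k tau) <= c1 e^(beta k tau), lets finitely many orbits approximate the rest.
   The map t |-> theta_t g need not be Hoelder, so for - M x < t <= T the
   Hoelder continuity of the process is used instead, on a time grid whose
   number of nodes is polynomial in e^x. *)
Require Import Defs.
From HB Require Import structures.
From mathcomp Require Import all_boot all_order all_algebra.
From mathcomp Require Import all_classical all_reals all_analysis.
From mathcomp Require Import lra.

Set Implicit Arguments.
Unset Strict Implicit.
Unset Printing Implicit Defensive.

Import Order.TTheory GRing.Theory Num.Theory.
Import numFieldNormedType.Exports.

Local Open Scope classical_set_scope.
Local Open Scope ring_scope.

(** * Elementary exponential bounds *)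

Lemma affine_le_expR (R : realType) (a b x : R) :
  1 <= x -> a * x + b <= expR ((`|a| + `|b|) * x).
Proof.
move=> x1; apply: (@le_trans _ _ ((`|a| + `|b|) * x)).
  rewrite mulrDl lerD//; first by rewrite ler_pM2r ?ler_norm //; lra.
  by rewrite (le_trans (ler_norm b))// ler_peMr.
by rewrite (le_trans _ (expR_ge1Dx _))// lerDr.
Qed.

Lemma exp_le_expR (R : realType) (m k : nat) (a b x : R) :
  1 <= x -> 0 <= a -> 0 <= b -> k%:R <= a * x + b ->
  (m ^ k)%N%:R <= expR (m%:R * (a + b) * x).
Proof.
move=> x1 a0 b0 kx; rewrite natrX.
apply: (@le_trans _ _ (expR m%:R ^+ k)).
  by rewrite lerXn2r ?nnegrE ?expR_ge0// (le_trans _ (expR_ge1Dx _))// lerDr.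
rewrite -expRM_natr ler_expR -mulrA ler_wpM2l//.
by rewrite (le_trans kx)// mulrDl lerD2l ler_peMr.
Qed.

(** As [2 <= expR 1], refining the scale by one unit of x makes room for a sum of two errors. *)
Lemma twice_expR_le (R : realType) (x : R) :
  expR (- (x + 1)) + expR (- (x + 1)) <= expR (- x).
Proof.
have -> : expR (- x) = expR 1 * expR (- (x + 1)).
  by rewrite -expRD; congr expR; lra.
have := expR_ge1Dx (1 : R); have := expR_gt0 (- (x + 1)); nra.
Qed.

(** * Covers by pieces of small diameter, and box dimension *)

Section Coverings.
Variable R : realType.
Implicit Types Z : pseudoMetricType R.

(* Pieces are constrained by diameter rather than by centres, so that they can
   be intersected with any set and pushed forward by Lipschitz maps. *)
Definition covered Z (K : set Z) (d : R) (n : nat) :=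
  exists V : 'I_n -> set Z, K `<=` \bigcup_i V i /\
    forall i x y, V i x -> V i y -> ball x d y.

Lemma covered_fin Z (K : set Z) d (I : finType) (V : I -> set Z) :
  K `<=` \bigcup_i V i -> (forall i x y, V i x -> V i y -> ball x d y) ->
  covered K d #|I|.
Proof.
move=> KV dV; exists (fun k => V (enum_val k)); split=> [x /KV [i _ Vix]|k].
  by exists (enum_rank i) => //; rewrite enum_rankK.
exact: dV.
Qed.

Lemma covered_sub Z (K K' : set Z) d n :
  K `<=` K' -> covered K' d n -> covered K d n.
Proof. by move=> KK' [V [K'V dV]]; exists V; split=> //; exact: subset_trans K'V. Qed.

Lemma covered_le Z (K : set Z) (d d' : R) n :
  d <= d' -> covered K d n -> covered K d' n.
Proof.
move=> dd' [V [KV dV]]; exists V; split=> // i x y Vx Vy.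
exact: le_ball dd' _ (dV _ _ _ Vx Vy).
Qed.

Lemma covered_bigcup Z (K : set Z) d (I : finType) n (W : I -> set Z) :
  K `<=` \bigcup_i W i -> (forall i, covered (W i) d n) ->
  covered K d (#|I| * n)%N.
Proof.
move=> KW /choice[V VP]; rewrite -[n in (_ * n)%N]card_ord -card_prod.
apply: (covered_fin (V := fun p : I * 'I_n => V p.1 p.2))
  => [x /KW[i _ /(VP i).1[k _ Vx]]|[i k]].
  by exists (i, k).
exact: (VP i).2.
Qed.

Lemma covered_setU Z (K K' : set Z) d n n' :
  covered K d n -> covered K' d n' -> covered (K `|` K') d (n + n')%N.
Proof.
move=> [V [KV dV]] [V' [KV' dV']].
rewrite -[n in (n + _)%N]card_ord -[n' in (_ + n')%N]card_ord -card_sum.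
apply: (covered_fin (V := fun s : 'I_n + 'I_n' =>
  match s with inl i => V i | inr i => V' i end)).
  by move=> x [/KV[i _ Vx]|/KV'[i _ Vx]]; [exists (inl i)|exists (inr i)].
by case=> i; [exact: dV|exact: dV'].
Qed.

Lemma ball_cover_covered Z (K : set Z) r n (c : 'I_n -> Z) :
  K `<=` \bigcup_i ball (c i) r -> covered K (r + r) n.
Proof.
move=> Kc; exists (fun i => ball (c i) r); split=> // i x y cx cy.
exact: ball_triangle (ball_sym cx) cy.
Qed.

(** Any point of a piece can serve as its centre; [z0] is the default for empty pieces. *)
Lemma covered_ball_cover Z (z0 : Z) (K : set Z) d n :
  covered K d n -> exists c : 'I_n -> Z, K `<=` \bigcup_i ball (c i) d.
Proof.
move=> [V [KV dV]]; exists (fun i => xget z0 (V i)) => x /KV[i _ Vx].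
by exists i => //; apply: (dV i) => //; exact: (xgetI z0 Vx).
Qed.

Lemma covered_set0 Z d n : covered (@set0 Z) d n.
Proof. by exists (fun=> set0); split=> [x|i x y]. Qed.

Lemma compact_covered (V : normedModType R) (K : set V) (d : R) :
  0 < d -> compact K -> exists n, covered K d n.
Proof.
move=> d0; rewrite compact_cover => /(_ V K (fun x => ball x (d / 2))).
case=> [|x Kx|D DK KD].
- by move=> x _; apply: ball_open; rewrite divr_gt0.
- by exists x => //=; apply: ballxx; rewrite divr_gt0.
pose s : seq V := finmap.enum_fset D; exists (size s), (fun i => ball s`_i (d / 2)); split.
  move=> x /KD[y /= Dy yx]; have sy : (index y s < size s)%N by rewrite index_mem.
  by exists (Ordinal sy) => //=; rewrite nth_index.
by move=> i x y ix iy; rewrite [d]splitr; exact: ball_triangle (ball_sym ix) iy.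
Qed.

(* The substitution r = expR (- x) turns bounds polynomial in 1/r into bounds
   exponential in x; K may depend on x because an orbit is split into an early
   and a late part at a time that depends on the scale. *)
Definition poly_covered Z (K : R -> set Z) :=
  exists D : R, forall x, 1 <= x ->
    exists n, covered (K x) (expR (- x)) n /\ n%:R <= expR (D * x).

Lemma poly_covered_ge Z (K : set Z) (x0 D : R) :
  (forall x, x0 <= x ->
    exists n, covered K (expR (- x)) n /\ n%:R <= expR (D * x)) ->
  poly_covered (fun=> K).
Proof.
(* For x below [x0] the cover at the finer scale [Num.max x0 x] serves, and
   [Num.max x0 x <= m * x]. *)
move=> KD; pose m := Num.max x0 1; exists (`|D| * m) => x x1.
have x0x : x0 <= Num.max x0 x by rewrite le_max lexx.
have [n [Kn nD]] := KD _ x0x.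
exists n; split.
  by apply: covered_le Kn; rewrite ler_expR lerN2 le_max lexx orbT.
apply: le_trans nD _; rewrite ler_expR.
apply: (@le_trans _ _ (`|D| * Num.max x0 x)).
  rewrite ler_wpM2r ?ler_norm// (le_trans (le_trans ler01 x1))//.
  by rewrite le_max lexx orbT.
have m1 : 1 <= m by rewrite le_max lexx orbT.
have mx0 : x0 <= m by rewrite le_max lexx.
by rewrite -mulrA ler_wpM2l// ge_max; apply/andP; split; nra.
Qed.

Lemma covering_number_ge0 Z (K : set Z) r : (0 <= covering_number K r)%E.
Proof. by apply: le_ereal_inf_tmp => _ [n _ <-]; rewrite lee_fin. Qed.

Lemma box_dim_poly_covered Z (K : set Z) :
  (box_dim K < +oo)%E -> poly_covered (fun=> K).
Proof.
move=> /ereal_inf_lt[_ [V /= Vnear <-]] supV.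
have [D DP] : exists D : R, forall r, V r ->
    (lne (covering_number K r) * ((- ln r)^-1)%:E <= D%:E)%E.
  have supub r : V r -> (lne (covering_number K r) * ((- ln r)^-1)%:E <= ereal_sup
    [set lne (covering_number K r) * ((- ln r)^-1)%:E | r in V])%E.
    by move=> Vr; apply: ereal_sup_ubound; exists r.
  case: (ereal_sup _) supV supub => [D _ DP|//|_ DP]; first by exists D.
  (* A supremum equal to -oo makes every quotient -oo, so any real bound holds. *)
  by exists 0 => r /DP; rewrite leeNy_eq => /eqP ->; exact: leNye.
case: Vnear => e /= e0 eV.
(* Balls of radius [expR (- (x + 1))] are pieces of diameter [expR (- x)]. The factor 2 absorbs
   [x + 1 <= 2 * x]; the final 1 absorbs the two terms of the count below, as [2 <= expR x]. *)
apply: (@poly_covered_ge _ _ (Num.max 1 (- ln e)) (2 * `|D| + 1)) => x.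
rewrite ge_max => /andP[x1 xe].
have Vx : V (expR (- (x + 1))).
  apply: eV; last exact: expR_gt0.
  rewrite /= sub0r normrN gtr0_norm ?expR_gt0// -[e in _ < e]lnK ?posrE//.
  by rewrite ltr_expR; lra.
(* Adding 1 makes the bound strict, so the infimum yields an actual cover. *)
have [n [c Kc] nD] : exists2 n,
    exists c : 'I_n -> Z, K `<=` \bigcup_i ball (c i) (expR (- (x + 1))) &
    n%:R < expR (D * (x + 1)) + 1.
  have : (covering_number K (expR (- (x + 1))) < (expR (D * (x + 1)) + 1)%:E)%E.
    have := DP _ Vx; rewrite expRK opprK lee_pdivrMr; last lra.
    rewrite -EFinM => lD; apply: (@le_lt_trans _ _ (expR (D * (x + 1)))%:E); last first.
      by rewrite lte_fin; lra.
    rewrite -[X in (X <= _)%E]lneK.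
      by rewrite -[X in (_ <= X)%E]/(expeR (D * (x + 1))%:E) lee_expeR.
    by rewrite in_itv /= leey andbT covering_number_ge0.
  by move=> /ereal_inf_lt[_ [n nK <-]]; rewrite lte_fin => nD; exists n.
exists n; split.
  by apply: covered_le (ball_cover_covered Kc); exact: twice_expR_le.
have /ltW/le_trans -> // := nD.
have e1 : expR (D * (x + 1)) <= expR (2 * `|D| * x).
  by rewrite ler_expR; have := ler_norm D; have := normr_ge0 D; nra.
have e2 : 1 <= expR (2 * `|D| * x).
  by rewrite -[X in X <= _]expR0 ler_expR; have := normr_ge0 D; nra.
have e3 : 2 <= expR x by have := expR_ge1Dx x; lra.
by rewrite mulrDl mul1r expRD; nra.
Qed.

Lemma poly_covered_box_dim Z (z0 : Z) (K : set Z) :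
  poly_covered (fun=> K) -> (box_dim K < +oo)%E.
Proof.
move=> [D DP].
apply: (@le_lt_trans _ _ (D%:E)%E); last exact: ltry.
(* For [r < expR (- 1)] the parameter [x = - ln r] is at least 1, where [DP] applies. *)
apply: ge_ereal_inf; eexists; first (exists [set r | 0 < r < expR (- 1)] => //).
  exists (expR (- 1)) => /=; first exact: expR_gt0.
  move=> r /=; rewrite sub0r normrN => re r0; rewrite r0/=.
  exact: le_lt_trans (ler_norm r) re.
apply: ge_ereal_sup => _ [r /= /andP[r0 r1] <-].
have lr : 1 <= - ln r.
  have : ln r < ln (expR (- 1)) by rewrite ltr_ln ?posrE ?expR_gt0.
  by rewrite expRK; lra.
have [n [/(covered_ball_cover z0)[c Kc] nD]] := DP _ lr.
rewrite lee_pdivrMr; last by rewrite ?opprK; lra.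
have cn : (covering_number K r <= n%:R%:E)%E.
  apply: ereal_inf_lbound; exists n => //; exists c.
  by move: Kc; rewrite opprK lnK ?posrE.
apply: (@le_trans _ _ (lne n%:R%:E)).
  by rewrite lee_lne// in_itv /= leey andbT ?lee_fin// covering_number_ge0.
(* A cover by no balls has logarithm -oo. *)
case: n cn nD {Kc c} => [|n] _ nD; first by rewrite le0_lneNy ?lee_fin// leNye.
by rewrite lne_EFin// -EFinM lee_fin -[leRHS]expRK ler_ln ?posrE ?expR_gt0.
Qed.

Lemma poly_covered_setU Z (K K' : R -> set Z) :
  poly_covered K -> poly_covered K' -> poly_covered (fun x => K x `|` K' x).
Proof.
move=> [D DP] [D' DP']; exists (`|D| + `|D'| + 1) => x x1.
have [n [Kn nD]] := DP _ x1; have [n' [Kn' nD']] := DP' _ x1.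
exists (n + n')%N; split; first exact: covered_setU.
have e1 : expR (D * x) <= expR ((`|D| + `|D'|) * x).
  by rewrite ler_expR; have := ler_norm D; have := normr_ge0 D'; nra.
have e2 : expR (D' * x) <= expR ((`|D| + `|D'|) * x).
  by rewrite ler_expR; have := ler_norm D'; have := normr_ge0 D; nra.
have e3 : 2 <= expR x by have := expR_ge1Dx x; lra.
have e4 := expR_gt0 ((`|D| + `|D'|) * x).
by rewrite natrD mulrDl mul1r expRD; nra.
Qed.

End Coverings.

(** * One smoothing step and its iteration *)

Lemma smoothing_covered (R : realType) (X Y : normedModType R)
    (j : {linear Y -> X}) (k : R) :
  compact_embedding j -> 0 < k ->
  exists N, forall (f : X -> X) (W : set X) (rho : R), 0 < rho ->
    (forall x y, W x -> W y ->
      exists2 w : Y, j w = f x - f y & `|w| <= k * `|x - y|) ->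
    (forall x y, W x -> W y -> ball x rho y) ->
    covered (f @` W) (rho * expR (- 1)) N.
Proof.
move=> [_ _ jcpt] k0.
(* The unit ball of [Y] is covered once, before [f], [W] and [rho] are given, so [N] depends only on
   [j] and [k]. *)
have /jcpt jcpt1 : bounded_set [set w : Y | `|w| <= 1].
  exists 1; split; first exact: num_real.
  by move=> M M1 w /= w1; exact: le_trans w1 (ltW M1).
have e0 : 0 < (k * expR 1)^-1 by rewrite invr_gt0 mulr_gt0 ?expR_gt0.
have [N [V [KV dV]]] := compact_covered e0 jcpt1.
exists N => f W rho rho0 fW dW.
have [->|/set0P[x0 Wx0]] := eqVneq W set0.
  by rewrite image_set0; exact: covered_set0.
have kr0 : 0 < k * rho by rewrite mulr_gt0.
(* The vectors [f x - f x0] are images of points of the [Y]-ball of radius [k * rho]. Rescaling by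
   [k * rho] turns diameter [(k * expR 1)^-1] into [rho * expR (- 1)]. *)
exists (fun i => [set z | V i ((k * rho)^-1 *: (z - f x0))]); split.
  move=> _ [x Wx <-]; have [w jw wx] := fW _ _ Wx Wx0.
  apply: KV; apply: subset_closure; exists ((k * rho)^-1 *: w).
    rewrite /= normrZ gtr0_norm ?invr_gt0// ler_pdivrMl// mulr1.
    apply: le_trans wx _; rewrite ler_wpM2l ?(ltW k0)//.
    by have := dW _ _ Wx Wx0; rewrite -ball_normE => /ltW.
  by rewrite linearZ jw.
move=> i x y /= Vx Vy; have := dV _ _ _ Vx Vy.
rewrite -!ball_normE /= -scalerBr opprB addrA subrK normrZ gtr0_norm ?invr_gt0//.
rewrite ltr_pdivrMl// invfM expRN => /lt_le_trans; apply.
by rewrite mulrACA divff ?gt_eqF// mul1r.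
Qed.

Lemma iterate_covered (R : realType) (X : pseudoMetricType R) (b : R) (N : nat)
    (S : nat -> set X) (f : nat -> X -> X) :
  (forall k, S k.+1 `<=` f k @` S k) -> covered (S 0%N) (expR b) 1 ->
  (forall k (W : set X) rho, 0 < rho -> W `<=` S k ->
    (forall x y, W x -> W y -> ball x rho y) ->
    covered (f k @` W) (rho * expR (- 1)) N) ->
  forall k, covered (S k) (expR (b - k%:R)) (N ^ k).
Proof.
move=> Sf S0 fN; elim=> [|k [V [SV dV]]]; first by rewrite subr0 expn0.
rewrite expnSr -[(N ^ k)%N]card_ord.
apply: (covered_bigcup (W := fun i => f k @` (V i `&` S k))).
  by move=> _ /Sf[x Sx <-]; have [i _ Vx] := SV _ Sx; exists i => //; exists x.
move=> i; have -> : b - k.+1%:R = (b - k%:R) + - 1 by rewrite -natr1; lra.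
rewrite expRD; apply: fN; [exact: expR_gt0|by move=> x []|].
by move=> x y [Vx _] [Vy _]; exact: dV Vx Vy.
Qed.

(** * Sections of the attractor as images of the absorbing set *)

Section Dynamics.
Variables (R : realType) (Xi : metricType R) (X Y : completeNormedModType R).
Variables (th : R -> Xi -> Xi) (g : Xi) (U : Xi -> R -> R -> X -> X).
Variables (BB : set X) (A : R -> set X).
Hypothesis th_group : operator_group th.
Hypothesis U_system : evolution_system th (hull th g) U.
Hypothesis BB_bounded : bounded_set BB.
Hypothesis BB_absorbing : uniformly_absorbing (hull th g) U BB.
Hypothesis A_attractor : is_pullback_attractor (U g) A.

Let Sigma := hull th g.

Lemma hull_th sigma t : Sigma sigma -> Sigma (th t sigma).
Proof. by case: U_system => _ inv _ _ Ss; rewrite /Sigma -(inv t); exists sigma. Qed.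

Lemma hull_orbit t : Sigma (th t g).
Proof. by apply: subset_closure; exists t. Qed.
Arguments hull_orbit : clear implicits.

Lemma hull_base : Sigma g.
Proof. by rewrite -[g](th_group.1 g); exact: hull_orbit. Qed.

(** Invariance of [A] and the translation identity trade the initial time [t - s] for the shifted
    symbol, so estimates uniform in the symbol apply. *)
Lemma attractor_pullback t s : 0 <= s -> A t = U (th (t - s) g) s 0 @` A (t - s).
Proof.
case: U_system A_attractor => _ _ _ Uth [_ _ UA _] s0.
rewrite -(UA t (t - s)) ?gerBl//; apply: eq_imagel => x _.
by rewrite (Uth _ _ _ _ _ hull_base s0) add0r [s + _]addrC subrK.
Qed.

(** The union of all sections is bounded, hence absorbed after a time [tB]; each section is the
    image of an earlier one after that time. *)
Lemma attractor_sub_absorbing t : A t `<=` BB.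
Proof.
case: A_attractor => _ Abd _ _; have [tB tB0 BBtB] := BB_absorbing Abd.
rewrite (attractor_pullback t tB0) => _ [x Ax <-].
have := BBtB _ _ (lexx tB) (hull_orbit (t - tB)); apply; exists x => //.
by exists (t - tB).
Qed.

Lemma attractor_sub_orbit t s : 0 <= s -> A t `<=` U (th (t - s) g) s 0 @` BB.
Proof.
move=> s0; rewrite (attractor_pullback t s0).
by apply: image_subset; exact: attractor_sub_absorbing.
Qed.

Lemma absorbing_time : exists2 tau : R, 1 <= tau &
  forall t sigma, tau <= t -> Sigma sigma -> U sigma t 0 @` BB `<=` BB.
Proof.
have [tB _ BBtB] := BB_absorbing BB_bounded.
exists (Num.max 1 tB) => [|t sigma]; first by rewrite le_max lexx.
by rewrite ge_max => /andP[_ tt] Ss; exact: BBtB.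
Qed.

Lemma orbit_covered (j : {linear Y -> X}) (kappa tau : R) :
  compact_embedding j -> 0 < kappa -> 0 < tau ->
  (forall t sigma, tau <= t -> Sigma sigma -> U sigma t 0 @` BB `<=` BB) ->
  (forall sigma, Sigma sigma -> forall x y, BB x -> BB y ->
     exists2 w : Y, j w = U sigma tau 0 x - U sigma tau 0 y
                  & `|w| <= kappa * `|x - y|) ->
  exists N b, 0 <= b /\ forall sigma k, Sigma sigma ->
    covered (U sigma (k%:R * tau) 0 @` BB) (expR (b - k%:R)) (N ^ k).
Proof.
move=> jemb kappa0 tau0 BBtau Usmooth.
have [N NP] := smoothing_covered jemb kappa0.
have [b b0 bBB] : exists2 b : R, 0 <= b & forall x, BB x -> `|x| <= b.
  have [M [_ MP]] := BB_bounded; exists (`|M| + 1); first by rewrite addr_ge0.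
  by apply: MP; rewrite (le_lt_trans (ler_norm M))// ltrDl.
(* Points of [BB] are at distance at most [b + b], less than [expR (b + b)], so [BB] is one
   piece. *)
exists N, (b + b); split=> [|sigma k Ss]; first by rewrite addr_ge0.
have [_ _ proc Uth] := U_system.
have [_ U0 Ucomp _] := proc _ Ss.
have SBB i : U sigma (i%:R * tau) 0 @` BB `<=` BB.
  (* Absorption starts only at [tau]; at time 0 the map is the identity. *)
  case: i => [|i] x; first by rewrite mul0r => -[y By <-]; rewrite U0.
  by apply: BBtau => //; rewrite ler_peMl ?ler1n// ltW.
apply: (iterate_covered (S := fun k => U sigma (k%:R * tau) 0 @` BB)
  (f := fun k => U (th (k%:R * tau) sigma) tau 0)).
- move=> i _ [x Bx <-]; exists (U sigma (i%:R * tau) 0 x); first by exists x.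
  have it0 : 0 <= i%:R * tau by rewrite mulr_ge0// ltW.
  by rewrite Uth ?(ltW tau0)// add0r Ucomp ?lerDr ?(ltW tau0)// -natr1 mulrDl mul1r addrC.
- exists (fun=> BB); split; first by move=> x /SBB Bx; exists ord0.
  move=> _ x y Bx By; rewrite -ball_normE /=.
  have := ler_normB x y; have := bBB _ Bx; have := bBB _ By.
  have := expR_ge1Dx (b + b); lra.
move=> i W rho rho0 WS; apply: NP => // x y /WS/SBB Bx /WS/SBB By.
by apply: Usmooth => //; exact: hull_th.
Qed.

Lemma symbols_covered (Sigma_m : set Xi) (C eta1 : R) :
  (box_dim Sigma_m < +oo)%E -> 0 < eta1 -> 1 <= C ->
  (forall t, (dist_to_set (th t g) Sigma_m <= (C * expR (eta1 * t))%:E)%E) ->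
  exists2 M, 0 <= M &
    poly_covered (fun x => [set th s g | s in [set s | s <= - (M * x)]]).
Proof.
move=> /box_dim_poly_covered[D DP] eta0 C1 Sm.
(* With [C < expR C], this rate brings the symbols at times [s <= - (M * x)] within
   [expR (- (x + 2))] of [Sigma_m]. *)
pose M := (C + 4) / eta1; exists M; first by rewrite divr_ge0//; lra.
exists (3 * `|D|) => x x1.
have [|n [[V [SV dV]] nD]] := DP (x + 2); first lra.
exists n; split; last first.
  by apply: le_trans nD _; rewrite ler_expR; have := ler_norm D; have := normr_ge0 D; nra.
have e1 : expR (- (x + 2)) + expR (- (x + 2)) <= expR (- (x + 1)).
  by have := twice_expR_le (x + 1); have -> : x + 1 + 1 = x + 2 by lra.
have e2 := twice_expR_le x.
(* The pieces of [Sigma_m] are thickened by their own scale; the three distances add up to at most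
   [expR (- x)]. *)
exists (fun i => [set xi | exists2 eta, V i eta & ball xi (expR (- (x + 2))) eta]).
split.
  move=> _ [s /= sM <-].
  have : (dist_to_set (th s g) Sigma_m < (expR (- (x + 2)))%:E)%E.
    apply: le_lt_trans (Sm s) _; rewrite lte_fin.
    have -> : expR (- (x + 2)) = expR C * expR (- (x + 2) - C).
      by rewrite -expRD; congr expR; lra.
    apply: ltr_pM; rewrite ?expR_ge0//; first lra.
      by have := expR_ge1Dx C; lra.
    rewrite ltr_expR.
    apply: (@le_lt_trans _ _ (eta1 * - (M * x))); first by rewrite ler_pM2l.
    by rewrite mulrN mulrA /M [eta1 * _]mulrC divfK ?gt_eqF//; nra.
  move=> /ereal_inf_lt[_ [eta Seta <-]]; rewrite lte_fin => d.
  by have [i _ Vi] := SV _ Seta; exists i => //; exists eta => //; rewrite ballEmdist.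
move=> i y z [p Vp py] [q Vq qz].
have yz := ball_triangle (ball_triangle py (dV _ _ _ Vp Vq)) (ball_sym qz).
by apply: le_ball yz; have := expR_gt0 (- (x + 2)); lra.
Qed.

(** A single symbol [s0] of [S] represents all: points are sorted by the piece that the [s0]-orbit
    of the same initial point visits. Comparing two points replaces the symbol twice, at cost
    [L * d] each. *)
Lemma symbol_piece_covered (S : set Xi) (t d L r : R) (N : nat) :
  0 <= d -> 0 <= L -> S `<=` Sigma -> (forall s s', S s -> S s' -> ball s d s') ->
  (forall s s' x, Sigma s -> Sigma s' -> BB x ->
    `|U s t 0 x - U s' t 0 x| <= L * mdist s s') ->
  (forall s, Sigma s -> covered (U s t 0 @` BB) r N) ->
  covered (\bigcup_(s in S) (U s t 0 @` BB)) (r + 2 * (L * d)) N.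
Proof.
move=> d0 L0 SS dS UL Ucov.
have [->|/set0P[s0 Ss0]] := eqVneq S set0.
  by rewrite bigcup_set0; exact: covered_set0.
have [V [UV dV]] := Ucov _ (SS _ Ss0).
exists (fun i => [set p | exists s y,
  [/\ S s, BB y, U s t 0 y = p & V i (U s0 t 0 y)]]); split.
  move=> _ [s Ss [y By <-]].
  by have [|i _ Vi] := UV (U s0 t 0 y); [exists y|exists i => //; exists s, y].
move=> i _ _ [s [y [Ss By <-]]] Vy [s' [y' [Ss' By' <- Vy']]].
have := dV _ _ _ Vy Vy'; rewrite -!ball_normE /= => dyy.
have Ud u z : S u -> BB z -> `|U u t 0 z - U s0 t 0 z| <= L * d.
  move=> Su Bz; apply: le_trans (UL _ _ _ (SS _ Su) (SS _ Ss0) Bz) _.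
  by rewrite ler_wpM2l//; have := dS _ _ Su Ss0; rewrite ballEmdist => /ltW.
have := Ud _ _ Ss By; have := Ud _ _ Ss' By'.
rewrite [`|U s' _ _ _ - _|]distrC => d1 d2.
have t1 := ler_distD (U s0 t 0 y) (U s t 0 y) (U s' t 0 y').
have t2 := ler_distD (U s0 t 0 y') (U s0 t 0 y) (U s' t 0 y').
lra.
Qed.

(** * Covering the early and the late sections *)

Section Attractor.
Variables (tau b c1 beta : R) (N : nat) (L : R -> R).
Hypothesis tau_ge1 : 1 <= tau.
Hypothesis b_ge0 : 0 <= b.
Hypothesis Ucov : forall sigma k, Sigma sigma ->
  covered (U sigma (k%:R * tau) 0 @` BB) (expR (b - k%:R)) (N ^ k).

Lemma step_count (x : R) : 1 <= x -> exists k : nat,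
  [/\ (0 < k)%N, k%:R <= x + b + 1, expR (b - k%:R) <= expR (- x) &
      (N ^ k)%N%:R <= expR (N%:R * (b + 2) * x)].
Proof.
(* The successor puts k above [x + b], which gives the scale, and keeps it positive, so that later
   [1 <= k%:R * tau]. *)
have b0 := b_ge0; move=> x1; pose k := (Num.trunc (x + b)).+1; exists k.
have xb0 : 0 <= x + b by lra.
have /andP[k1 k2] := truncn_itv xb0.
have k3 : k%:R <= x + b + 1 by rewrite /k -natr1 lerD2r.
split=> //; first by rewrite ler_expR /k; lra.
have -> : b + 2 = 1 + (b + 1) by lra.
by apply: exp_le_expR => //; lra.
Qed.

(** [Ucov] is uniform in the symbol, so one count n serves all times t. *)
Lemma section_covered : exists2 D : R, 0 <= D & forall x, 1 <= x ->
  exists n, (forall t, covered (A t) (expR (- x)) n) /\ n%:R <= expR (D * x).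
Proof.
have b0 := b_ge0; have tau1 := tau_ge1.
exists (N%:R * (b + 2)) => [|x x1]; first by rewrite mulr_ge0//; lra.
have [k [k0 _ kx Nk]] := step_count x1; exists (N ^ k)%N; split=> // t.
apply: covered_le kx _; apply: covered_sub (Ucov k (hull_orbit (t - k%:R * tau))).
by apply: attractor_sub_orbit; rewrite mulr_ge0//; lra.
Qed.

Lemma backward_covered (M : R) :
  0 < c1 -> 0 < beta -> (forall t, 1 <= t -> 1 <= L t <= c1 * expR (beta * t)) ->
  (forall t s1 s2 x, 1 <= t -> Sigma s1 -> Sigma s2 -> BB x ->
    `|U s1 t 0 x - U s2 t 0 x| <= L t * mdist s1 s2) ->
  0 <= M -> poly_covered (fun x => [set th s g | s in [set s | s <= - (M * x)]]) ->
  exists M', poly_covered (fun x => \bigcup_(t in [set t | t <= - (M' * x)]) A t).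
Proof.
have b0 := b_ge0; have tau1 := tau_ge1.
move=> c10 beta0 L1 UL M0 [D DP].
pose bt := beta * tau.
have bt0 : 0 < bt by rewrite mulr_gt0//; lra.
(* Chosen so that the symbol scale z below satisfies [z <= Z * x] for [1 <= x]. *)
pose Z := 2 + 2 * c1 + bt * (b + 3).
have btb0 : 0 <= bt * (b + 3) by rewrite mulr_ge0//; lra.
have Z0 : 0 <= Z by rewrite /Z; lra.
exists (M * Z), (`|D| * Z + 2 * (N%:R * (b + 2))) => x x1.
have [|k [k0 kx ek Nk]] := @step_count (x + 1); first lra.
(* As [k%:R <= x + b + 2] and [2 * c1 <= expR (2 * c1)], symbols [expR (- z)] apart cost at most [2
   * L (k%:R * tau) * expR (- z) <= expR (- (x + 1))]. *)
pose z := x + 1 + 2 * c1 + bt * (x + b + 2).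
have zx : x + 1 + 2 * c1 <= z by rewrite lerDl mulr_ge0//; lra.
have zZ : z <= Z * x.
  have : 0 <= bt * (b + 2) * (x - 1) by rewrite !mulr_ge0//; lra.
  by rewrite /z /Z; nra.
have [|n [[V [SV dV]] nD]] := DP z; first lra.
exists (n * N ^ k)%N; split; last first.
  rewrite natrM mulrDl expRD; apply: ler_pM => //.
    apply: le_trans nD _; rewrite ler_expR.
    apply: (@le_trans _ _ (`|D| * z)); first by rewrite ler_wpM2r ?ler_norm//; lra.
    by rewrite -mulrA ler_wpM2l.
  apply: le_trans Nk _; rewrite ler_expR.
  have : 0 <= N%:R * (b + 2) * (x - 1) by rewrite !mulr_ge0//; lra.
  lra.
rewrite -[n in (n * _)%N]card_ord.
apply: (covered_bigcup (W := fun i =>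
    \bigcup_(s in V i `&` Sigma) (U s (k%:R * tau) 0 @` BB))).
  move=> p [t /= tM Ap].
  have kt0 : 0 <= k%:R * tau by rewrite mulr_ge0//; lra.
  have [y By yp] := attractor_sub_orbit kt0 Ap.
  have [|i _ Vi] := SV (th (t - k%:R * tau) g).
    exists (t - k%:R * tau) => //=.
    (* Starting k steps earlier only decreases the time, so the initial symbol still falls in the
       range covered at scale z. *)
    have : M * z <= M * Z * x by rewrite -mulrA ler_wpM2l.
    lra.
  by exists i => //; exists (th (t - k%:R * tau) g); [split=> //; exact: hull_orbit|exists y].
move=> i.
have kt1 : 1 <= k%:R * tau.
  have : (1 : R) <= k%:R by rewrite ler1n.
  by nra.
have /andP[Lk1 Lk2] := L1 _ kt1.
apply: (@covered_le _ _ _ (expR (b - k%:R) + 2 * (L (k%:R * tau) * expR (- z)))).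
  apply: le_trans (twice_expR_le x); apply: lerD => //.
  have -> : - (x + 1) = 2 * c1 + bt * (x + b + 2) + - z by rewrite /z; lra.
  rewrite 2!expRD mulrA ler_pM2r ?expR_gt0//.
  apply: (@le_trans _ _ (2 * (c1 * expR (beta * (k%:R * tau))))); first lra.
  rewrite mulrA ler_pM ?expR_ge0//; first lra.
    by have := expR_ge1Dx (2 * c1); lra.
  rewrite ler_expR [k%:R * _]mulrC mulrA -/bt ler_pM2l//; lra.
apply: symbol_piece_covered.
- exact: expR_ge0.
- lra.
- by move=> s [].
- by move=> s s' [Vs _] [Vs' _]; exact: dV Vs Vs'.
- by move=> s s' y Ss Ss' By; exact: UL.
by move=> s Ss; exact: Ucov.
Qed.

(** Each grid node carries a cover of its section; flowing for at most one grid step keeps each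
    piece small by the joint Hölder estimate in time and initial point. *)
Lemma forward_covered (M T gamma theta C : R) :
  0 < gamma -> 0 < theta ->
  (forall s x y t t', BB x -> BB y -> 0 <= t <= 1 -> 0 <= t' <= 1 ->
     `|U g (t + s) s x - U g (t' + s) s y|
       <= C * (`|x - y| `^ gamma + `|t - t'| `^ theta)) ->
  poly_covered (fun x =>
    \bigcup_(t in [set t | - (M * x) < t /\ t <= T]) A t).
Proof.
move=> gamma0 theta0 hold; have [D D0 DP] := section_covered.
pose W e := 2 + (3 + `|C|) / e.
(* The scale [expR (- w e x)] raised to the power e and multiplied by C is at most
   [expR (- (x + 2))], because C is at most the exponential of its absolute value. The leading 1
   gives [1 <= w e x], so grid steps are at most 1 and [DP] applies. *)
pose w e x := 1 + (x + 2 + `|C|) / e.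
have wW e x : 0 < e -> 1 <= x -> w e x <= W e * x.
  move=> e0 x1; rewrite /w /W [leRHS]mulrDl lerD//; first lra.
  by rewrite mulrAC ler_pM2r ?invr_gt0//; have := normr_ge0 C; nra.
have w1 e x : 0 < e -> 1 <= x -> 1 <= w e x.
  by move=> e0 x1; rewrite lerDl divr_ge0//; have := normr_ge0 C; lra.
have powW e x r : 0 < e -> 1 <= x -> 0 <= r -> r <= expR (- w e x) ->
    C * r `^ e <= expR (- (x + 2)).
  move=> e0 x1 r0 rw.
  have -> : - (x + 2) = `|C| + - (x + 2 + `|C|) by lra.
  rewrite expRD; apply: (@le_trans _ _ (`|C| * r `^ e)).
    by rewrite ler_wpM2r ?powR_ge0// ler_norm.
  apply: ler_pM => //; rewrite ?powR_ge0//.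
    by have := expR_ge1Dx `|C|; lra.
  apply: (@le_trans _ _ (expR (- w e x) `^ e)).
    by rewrite ge0_ler_powR ?nnegrE ?expR_ge0// ltW.
  rewrite -expRM ler_expR /w mulNr mulrDl divfK ?gt_eqF//; lra.
exists ((`|M| + `| `|T| + 1|) + W theta + D * W gamma) => x x1.
have [m [mD Am]] : exists m : nat, m%:R <= expR ((`|M| + `| `|T| + 1|) * x + w theta x) /\
    forall t, - (M * x) < t <= T -> exists i : 'I_m,
      0 <= t - (- (M * x) + i%:R * expR (- w theta x)) <= expR (- w theta x).
  pose h := expR (- w theta x).
  have h0 : 0 < h by exact: expR_gt0.
  (* A bound for the number of grid steps up to T, valid for either sign of M and T. *)
  pose y := (`|M * x| + `|T|) / h.
  have y0 : 0 <= y by rewrite divr_ge0 ?addr_ge0 ?(ltW h0).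
  have /andP[ty _] := truncn_itv y0.
  exists (Num.trunc y).+1; split.
    rewrite expRD -natr1.
    have a1 := affine_le_expR `|M| (`|T| + 1) x1; rewrite !normr_id in a1.
    have h1 : 1 <= expR (w theta x) by rewrite -[leLHS]expR0 ler_expR; have := w1 _ _ theta0 x1; lra.
    apply: (@le_trans _ _ ((`|M| * x + (`|T| + 1)) * expR (w theta x))).
      have -> : (`|M| * x + (`|T| + 1)) * expR (w theta x) = y + expR (w theta x).
        rewrite /y /h expRN invrK normrM [`|x|]ger0_norm; first lra.
        lra.
      by rewrite lerD.
    by rewrite ler_pM2r ?expR_gt0.
  move=> t /andP[t1 t2].
  (* The integer part of u indexes the last node not after t. *)
  pose u := (t + M * x) / h.
  have u0 : 0 <= u by rewrite divr_ge0 ?ltW//; lra.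
  have uy : (Num.trunc u < (Num.trunc y).+1)%N.
    rewrite ltnS le_truncn// ler_pM2r ?invr_gt0//.
    have := ler_norm (M * x); have := ler_norm T; lra.
  exists (Ordinal uy) => /=; have /andP[] := truncn_itv u0.
  by rewrite /u -natr1 ler_pdivlMr// ltr_pdivrMr// -/h; nra.
have [n [An nD]] := DP _ (w1 _ _ gamma0 x1).
exists (m * n)%N; split; last first.
  have -> : (`|M| + `| `|T| + 1| + W theta + D * W gamma) * x =
    (`|M| + `| `|T| + 1|) * x + W theta * x + D * (W gamma * x) by lra.
  rewrite natrM expRD ler_pM//.
    by apply: le_trans mD _; rewrite ler_expR lerD2l wW.
  by apply: le_trans nD _; rewrite ler_expR ler_wpM2l// wW.
have [_ _ UA _] := A_attractor.
pose s (i : 'I_m) := - (M * x) + i%:R * expR (- w theta x).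
pose J : set R := [set r | 0 <= r <= expR (- w theta x)].
have J1 r : J r -> 0 <= r <= 1.
  move=> /andP[-> /le_trans ->]//; rewrite -[leRHS]expR0 ler_expR.
  by have := w1 _ _ theta0 x1; lra.
rewrite -[m in (m * _)%N]card_ord.
apply: (covered_bigcup (W := fun i =>
    [set p | exists r y, [/\ J r, A (s i) y & U g (r + s i) (s i) y = p]])).
  move=> p [t /= [t1 t2] Ap].
  have [|i si] := Am t; first by rewrite t1.
  exists i => //; have sit : s i <= t by case/andP: si; rewrite subr_ge0.
  have : A t p by []; rewrite -(UA _ _ sit) => -[y Ay yp].
  by exists (t - s i), y; split=> //; rewrite subrK.
move=> i; have [V [AV dV]] := An (s i).
exists (fun l => [set p | exists r y,
  [/\ J r, A (s i) y, V l y & U g (r + s i) (s i) y = p]]); split.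
  by move=> p [r [y [Jr Ay <-]]]; have [l _ Vy] := AV _ Ay; exists l => //; exists r, y.
move=> l _ _ [r [y [Jr Ay Vy <-]]] [r' [y' [Jr' Ay' Vy' <-]]].
have := dV _ _ _ Vy Vy'; rewrite -!ball_normE /= => /ltW dy.
have dr : `|r - r'| <= expR (- w theta x).
  by rewrite ler_norml; case/andP: Jr; case/andP: Jr'; lra.
have := hold (s i) _ _ _ _ (attractor_sub_absorbing Ay) (attractor_sub_absorbing Ay')
  (J1 _ Jr) (J1 _ Jr').
(* The space and time errors sum to [expR (- (x + 1))] at most, strictly below [expR (- x)] as open
   balls require. *)
have := powW _ _ _ gamma0 x1 (normr_ge0 _) dy.
have := powW _ _ _ theta0 x1 (normr_ge0 _) dr.
have := twice_expR_le (x + 1); have -> : x + 1 + 1 = x + 2 by lra.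
have : expR (- (x + 1)) < expR (- x) by rewrite ltr_expR; lra.
lra.
Qed.

End Attractor.
End Dynamics.

(** * Assembling the two time ranges *)

Theorem corollary1p2 (R : realType) (Xi : metricType R)
  (X Y : completeNormedModType R)
  (th : R -> Xi -> Xi) (g : Xi) (U : Xi -> R -> R -> X -> X) (BB : set X)
  (j : {linear Y -> X}) (kappa : R -> R)
  (gamma theta : R) (C3 : R -> R) (P zeta : R)
  (L : R -> R) (c1 beta : R)
  (Sigma_m : set Xi) (eta1 C : R) (A : R -> set X)
  (* the base flow and the symbol space *)
  (Xi_complete : complete_space Xi)
  (th_group : operator_group th)
  (th_cont : forall t, continuous (th t))
  (th_jcont : continuous (fun p : R * Xi => th p.1 p.2))
  (U_system : evolution_system th (hull th g) U)
  (BB_closed : closed BB) (BB_bounded : bounded_set BB)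
  (BB_absorbing : uniformly_absorbing (hull th g) U BB)
  (j_embedding : compact_embedding j)
  (* The difference lies in Y, i.e. is j w, and its Y-norm is that of w *)
  (kappa_gt0 : forall t : R, 0 < t -> 0 < kappa t)
  (smoothing : forall t : R, 0 < t -> forall sigma, hull th g sigma ->
     forall x y, BB x -> BB y ->
     exists2 w : Y, j w = U sigma t 0 x - U sigma t 0 y
                  & `|w| <= kappa t * `|x - y|)
  (gamma_gt0 : 0 < gamma) (theta_gt0 : 0 < theta)
  (holder : forall r : R, 0 < r -> forall (s : R) sigma x y (t t' : R),
     hull th g sigma -> BB x -> BB y ->
     0 <= t <= r -> 0 <= t' <= r ->
     `|U sigma (t + s) s x - U sigma (t' + s) s y|
       <= C3 r * (`|x - y| `^ gamma + `|t - t'| `^ theta))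
  (P_ge1 : 1 <= P) (zeta_gt0 : 0 < zeta)
  (th_lip : forall (t : R) xi1 xi2, 0 <= t ->
     mdist (th t xi1) (th t xi2) <= P * expR (zeta * t) * mdist xi1 xi2)
  (c1_gt0 : 0 < c1) (beta_gt0 : 0 < beta)
  (L_bounds : forall t : R, 1 <= t -> 1 <= L t <= c1 * expR (beta * t))
  (symbol_lip : forall (t : R) sigma1 sigma2 x, 1 <= t ->
     hull th g sigma1 -> hull th g sigma2 -> BB x ->
     `|U sigma1 t 0 x - U sigma2 t 0 x| <= L t * mdist sigma1 sigma2)
  (* backward convergence of the symbol *)
  (Sm_compact : compact Sigma_m) (Sm_invariant : invariant_set th Sigma_m)
  (Sm_dim : (box_dim Sigma_m < +oo)%E)
  (Sm_alpha : alpha_limit th g `<=` Sigma_m)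
  (eta1_gt0 : 0 < eta1) (C_ge1 : 1 <= C)
  (Sm_attracts : forall t,
     (dist_to_set (th t g) Sigma_m <= (C * expR (eta1 * t))%:E)%E)
  (A_attractor : is_pullback_attractor (U g) A) :
  forall T : R, (box_dim (\bigcup_(t in [set t : R | (t <= T)%R]) A t) < +oo)%E.
Proof.
move=> T.
have [tau tau1 BBtau] := absorbing_time BB_bounded BB_absorbing.
have tau0 : 0 < tau by lra.
have [N [b [b0 Ucov]]] := orbit_covered U_system BB_bounded j_embedding
  (kappa_gt0 _ tau0) tau0 BBtau (smoothing _ tau0).
have [M M0 symb] := symbols_covered Sm_dim eta1_gt0 C_ge1 Sm_attracts.
have [M' back] := backward_covered th_group U_system BB_absorbing A_attractor
  tau1 b0 Ucov c1_gt0 beta_gt0 L_bounds symbol_lip M0 symb.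
have hold s x y t t' : BB x -> BB y -> 0 <= t <= 1 -> 0 <= t' <= 1 ->
    `|U g (t + s) s x - U g (t' + s) s y|
      <= C3 1 * (`|x - y| `^ gamma + `|t - t'| `^ theta).
  by move=> Bx By; apply: holder => //; exact: hull_base th_group.
have forw := forward_covered th_group U_system BB_absorbing
  A_attractor tau1 b0 Ucov M' T gamma_gt0 theta_gt0 hold.
apply: (poly_covered_box_dim 0).
have [D DP] := poly_covered_setU back forw.
exists D => x /DP[n [Kn nD]]; exists n; split=> //; apply: covered_sub Kn.
(* The splitting time [- (M' * x)] moves with the scale. *)
move=> p [t /= tT Ap]; have [tM|tM] := leP t (- (M' * x)).
  by left; exists t.
by right; exists t.
Qed.
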